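(* Let $K$ be a field of characteristic $0$, complete with respect to a discrete valuation, with perfect residue field of characteristic $p$, and let $L/K$ be a totally ramified cyclic extension of degree $p$ whose ramification number $u$ satisfies $\gcd(u,p)=1$. Then $T:=p\,v_K(p)-(p-1)u\ge1$; there exist a generator $\sigma$ of $\mathrm{Gal}(L/K)$ and $X\in L$ with $v_L(X)=-u$ and $v_L((\sigma-1)X-1)\ge T$; and $L/K$ has a Galois scaffold of tolerance $T$.
   Context: $v_K$, $v_L$ are the normalized valuations of $K$, $L$; $\mathfrak{P}_L$ is the maximal ideal of the valuation ring of $L$. Galois scaffold: let $L/K$ be totally ramified Galois of degree $p^n$, $G=\mathrm{Gal}(L/K)$, $\pi_K$ a prime of $K$, and $b_1\le\dots\le b_n$ the lower ramification numbers of $L/K$ with multiplicity. For $0\le a<p^n$ write $a=\sum_{i=1}^n a_{(n-i)}p^{n-i}$ ($0\le a_{(k)}<p$), put $\mathfrak{b}(a)=\sum_i a_{(n-i)}p^{n-i}b_i$, and for $t\in\mathbb{Z}$ let $\mathfrak{a}(t)$ be the unique $0\le a<p^n$ with $t\equiv-\mathfrak{b}(a)\bmod p^n$. For an integer $T\ge1$, $L/K$ has a Galois scaffold of tolerance $T$ (with shift parameters $b_1,\dots,b_n$) if all $b_i$ are prime to $p$ and there exist $\lambda_t\in L$ ($t\in\mathbb{Z}$) and $\Psi_1,\dots,\Psi_n\in K[G]$ with $v_L(\lambda_t)=t$, $\lambda_{t+p^n}=\pi_K\lambda_t$, $\Psi_i(1)=0$, and for all $i,j$: $\Psi_i\lambda_j-c\,\lambda_{j+p^{n-i}b_i}\in\lambda_{j+p^{n-i}b_i}\mathfrak{P}_L^{T}$,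 where $c=1$ if $\mathfrak{a}(j)_{(n-i)}\ge1$ and $c=0$ otherwise. *)

(* Defs.v *)
From HB Require Import structures.
From mathcomp Require Import all_boot all_order all_algebra.
From mathcomp Require Import all_fingroup all_solvable all_field.
From mathcomp Require Import ring_quotient generic_quotient.
From mathcomp Require Import boolp constructive_ereal.

Set Implicit Arguments.
Unset Strict Implicit.
Unset Printing Implicit Defensive.

Import Order.TTheory GRing.Theory Num.Theory.

Local Open Scope ring_scope.
Local Open Scope quotient_scope.

(* Normalized: the value group is all of Z. *)
Record discrete_valuation (F : fieldType) := DiscreteValuation {
  dval :> F -> \bar int;
  dval_neqNy : forall x, dval x <> -oo%E;
  dval_eqy : forall x, dval x = +oo%E <-> x = 0;
  dvalM : forall x y, dval (x * y) = (dval x + dval y)%E;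
  dvalD : forall x y, (Order.min (dval x) (dval y) <= dval (x + y))%E;
  dval_surj : forall n : int, exists x, dval x = n%:E }.

Section ResidueField.

Variables (F : fieldType) (v : discrete_valuation F).

Lemma dval0 : v 0 = +oo%E.
Proof. by apply/(dval_eqy v 0). Qed.

Lemma dval_fin x : x != 0 -> exists n : int, v x = n%:E.
Proof.
move=> /eqP x0; case E : (v x) => [n||]; first by exists n.
- by case: x0; apply/(dval_eqy v x).
- by case: (dval_neqNy E).
Qed.

Lemma dval1 : v 1 = 0%E.
Proof.
have [n vn] := dval_fin (oner_neq0 F).
have := dvalM v 1 1; rewrite mulr1 vn -EFinD => -[/eqP].
by rewrite -subr_eq0 opprD addNKr oppr_eq0 => /eqP ->.
Qed.

Lemma dvalN1 : v (-1) = 0%E.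
Proof.
have [n vn] : exists n : int, v (-1) = n%:E.
  by apply: dval_fin; rewrite oppr_eq0 oner_eq0.
have := dvalM v (-1) (-1); rewrite mulrNN mulr1 dval1 vn -EFinD => -[/eqP].
by rewrite eq_sym -mulr2n mulrn_eq0 /= => /eqP ->.
Qed.

Lemma dvalN x : v (- x) = v x.
Proof. by rewrite -mulN1r dvalM dvalN1 add0e. Qed.

Lemma dvalV x : x != 0 -> v x^-1 = (- v x)%E.
Proof.
move=> x0; have [n vn] := dval_fin x0.
have [m vm] : exists m : int, v x^-1 = m%:E by apply: dval_fin; rewrite invr_eq0.
have := dvalM v x x^-1; rewrite divff // dval1 vn vm -EFinD -EFinN => -[/eqP].
by rewrite eq_sym addrC addr_eq0 => /eqP ->.
Qed.

Definition vring_pred : {pred F} := fun x => (0%E <= v x)%E.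

Fact vring_pred_closed : subring_closed vring_pred.
Proof.
split=> [|x y|x y]; rewrite !unfold_in /vring_pred.
- by rewrite dval1.
- move=> x0 y0; apply: le_trans (dvalD v x (- y)).
  by rewrite dvalN le_min x0.
- by move=> x0 y0; rewrite dvalM adde_ge0.
Qed.

HB.instance Definition _ :=
  GRing.isSubringClosed.Build F vring_pred vring_pred_closed.

Record vring := VRing { vring_val :> F; vring_valP : vring_val \in vring_pred }.

HB.instance Definition _ := [isSub for vring_val].
HB.instance Definition _ := [Choice of vring by <:].
HB.instance Definition _ := [SubChoice_isSubComNzRing of vring by <:].

Definition vmax : {pred vring} := fun x => (0%E < v (val x))%E.

Fact vmax_idealr : idealr_closed vmax.
Proof.
split; rewrite ?unfold_in /vmax /=.
- by rewrite dval0.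
- by rewrite dval1 ltxx.
- move=> a x y; rewrite !unfold_in /vmax /= => x0 y0.
  apply: lt_le_trans (dvalD v _ _); rewrite lt_min y0 andbT.
  rewrite dvalM; apply: lt_le_trans x0 _.
  by rewrite leeDr //; exact: (vring_valP a).
Qed.

HB.instance Definition _ := isIdealr.Build vring vmax vmax_idealr.

Definition residue_field : Type := {ideal_quot vmax}.

HB.instance Definition _ := GRing.ComNzRing.on residue_field.

Lemma residue_eq0 (x : residue_field) : (x == 0) = (0%E < v (val (repr x)))%E.
Proof.
rewrite -[x in LHS](@reprK _ {ideal_quot vmax}).
by rewrite -[0](rmorph0 \pi_({ideal_quot vmax})) -Quotient.idealrBE subr0.
Qed.

Definition residue_inv (x : residue_field) : residue_field :=
  \pi_({ideal_quot vmax}) (insubd (0 : vring) (val (repr x))^-1).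

Fact residue_mulVf (x : residue_field) : x != 0 -> residue_inv x * x = 1.
Proof.
rewrite residue_eq0 -leNgt => vx_le0.
have vx : v (val (repr x)) = 0%E.
  by apply/le_anti; rewrite vx_le0; exact: (vring_valP (repr x)).
have x0 : val (repr x) != 0.
  by apply/eqP => x0; move: vx; rewrite x0 dval0.
rewrite -[x in _ * x](@reprK _ {ideal_quot vmax}) /residue_inv.
rewrite -[LHS](rmorphM \pi_({ideal_quot vmax})) -[RHS](rmorph1 \pi_({ideal_quot vmax})).
congr (\pi_({ideal_quot vmax}) _); apply: val_inj.
rewrite [LHS]/= val_insubd /=.
by rewrite unfold_in /vring_pred dvalV // vx oppe0 lexx mulVf.
Qed.

Fact residue_inv0 : residue_inv 0 = 0.
Proof.
rewrite /residue_inv -[RHS](rmorph0 \pi_({ideal_quot vmax})).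
congr (\pi_({ideal_quot vmax}) _); apply: val_inj; rewrite val_insubd /=.
have := residue_eq0 0; rewrite eqxx => /esym vy.
have [->|y0] := eqVneq (val (repr (0 : residue_field))) 0.
  by rewrite invr0 if_same.
by rewrite unfold_in /vring_pred dvalV // oppe_ge0 leNgt vy.
Qed.

HB.instance Definition _ :=
  GRing.ComNzRing_isField.Build residue_field residue_mulVf residue_inv0.

End ResidueField.

Definition perfect_field (F : fieldType) :=
  forall q : {poly F}, irreducible_poly q -> separable_poly q.

Definition complete_valuation (F : fieldType) (v : discrete_valuation F) :=
  forall x : nat -> F,
    (forall N : int, exists M : nat, forall m n : nat,
        (M <= m)%N -> (M <= n)%N -> (N%:E <= v (x m - x n)%R)%E) ->
    exists l : F, forall N : int, exists M : nat, forall m : nat,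
        (M <= m)%N -> (N%:E <= v (x m - l)%R)%E.

Section Extension.

Variables (K : fieldType) (L : splittingFieldType K).
Variables (vK : discrete_valuation K) (vL : discrete_valuation L).

Definition ramification_index (e : nat) :=
  (0 < e)%N /\ forall x : K, vL x%:A = ((e%:Z)%:E * vK x)%E.

Definition totally_ramified := ramification_index (\dim {:L}).

Definition lower_ram_group (i : int) : {set gal_of {:L}} :=
  [set s in 'Gal({:L} / 1)%g |
    `[< forall x : L, (0%E <= vL x)%E -> ((i + 1)%:E <= vL (s x - x)%R)%E >]].

Definition lower_ram_number (i : int) :=
  lower_ram_group i != lower_ram_group (i + 1).

(* The multiplicity of i is log_p |G_i : G_(i+1)|. *)
Definition lower_ram_numbers (p n : nat) (b : n.-tuple int) :=
  sorted <=%R b /\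
  forall i : int,
    count_mem i b = logn p #|lower_ram_group i : lower_ram_group (i + 1)%R|%g.

(* An element f of K[G], given by its coefficients, acting on L; the
   multiplication of K[G] plays no role here. *)
Definition group_alg_act (f : {ffun gal_of {:L} -> K}) (x : L) : L :=
  \sum_(s in 'Gal({:L} / 1)%g) f s *: s x.

End Extension.

Definition digit (p a k : nat) : nat := ((a %/ p ^ k) %% p)%N.

(* tnth b i is b_(i+1), so the power of p attached to it is p^(n-(i+1)). *)
Definition shift_b (p n : nat) (b : n.-tuple int) (a : nat) : int :=
  \sum_(i < n) (digit p a (n - i.+1) * p ^ (n - i.+1))%N%:Z * tnth b i.

(* The head is the only element of the list when all the b_i are prime to p. *)
Definition shift_a (p n : nat) (b : n.-tuple int) (t : int) : nat :=
  head 0%N [seq a <- iota 0 (p ^ n) |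
             (t == - shift_b p b a %[mod (p ^ n)%N%:Z])%Z].

(* For T >= 1, y ranges over the T-th power of the maximal ideal of L when
   T <= vL y. *)
Definition has_galois_scaffold (p n : nat) (K : fieldType)
    (vK : discrete_valuation K) (L : splittingFieldType K)
    (vL : discrete_valuation L) (piK : K) (T : int) : Prop :=
  [/\ galois 1 {:L}, \dim {:L} = (p ^ n)%N, totally_ramified vK vL,
      vK piK = 1%:E & 1 <= T] /\
  exists b : n.-tuple int,
    [/\ lower_ram_numbers vL p b,
        forall i, coprimez (tnth b i) p &
        exists (lambda : int -> L) (Psi : 'I_n -> {ffun gal_of {:L} -> K}),
          [/\ forall t, vL (lambda t) = t%:E,
              forall t, lambda (t + (p ^ n)%N%:Z) = piK *: lambda t,
              forall i, group_alg_act (Psi i) 1 = 0 &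
              forall (i : 'I_n) (j : int),
                let mu := lambda (j + (p ^ (n - i.+1))%N%:Z * tnth b i) in
                let c : L :=
                  if (0 < digit p (shift_a p b j) (n - i.+1))%N
                  then 1 else 0 in
                exists2 y : L, (T%:E <= vL y)%E &
                  group_alg_act (Psi i) (lambda j) - c * mu = mu * y]].

(* Main.v *)
(** Write [tau = sigma - 1] and let [u] be the ramification number. A
uniformizer [pi] of [L] gives a [K]-basis [1, pi, ..., pi^(p-1)] whose valuations
are distinct modulo [p]; reading [tau] off this basis, [tau] raises valuations by
exactly [u] on elements of valuation prime to [p], and by more than [u] on the
others. Take [x] of valuation [u]. Then [tau^k x] has valuation [(k+1)u] for
[k < p], and expanding [sigma^p = (1 + tau)^p] gives [tau S = 0] for
[S = tau^(p-1) x + p (...)]. Comparing valuations in [tau S = 0] yields [1 <= T],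
so [S] has valuation [pu] and [tau^(p-1) x / S] agrees with [1] up to valuation
[T]. Since [S] is fixed by [sigma], the elements [tau^(p-1-a) x / S], of valuation
[-au], form the scaffold up to powers of the uniformizer of [K], and
[X = tau^(p-2) x / S]. *)

Require Import Defs.
From HB Require Import structures.
From mathcomp Require Import all_boot all_order all_algebra.
From mathcomp Require Import all_fingroup all_solvable all_field.
From mathcomp Require Import ring_quotient generic_quotient boolp zify ring.
From mathcomp Require Import constructive_ereal.

Set Implicit Arguments.
Unset Strict Implicit.
Unset Printing Implicit Defensive.

Import Order.TTheory GRing.Theory Num.Theory.

Local Open Scope ring_scope.

(** * Arithmetic of a discrete valuation *)

Section Valuation.

Variables (F : fieldType) (v : discrete_valuation F).
Implicit Types (x y : F) (m n : int).

Definition val_ge n x := (n%:E <= v x)%E.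

Lemma val_ge0 n : val_ge n 0.
Proof. by rewrite /val_ge dval0 leey. Qed.

Lemma val_geW m n x : m <= n -> val_ge n x -> val_ge m x.
Proof. by move=> le_mn; apply: le_trans; rewrite lee_fin. Qed.

Lemma val_geD n x y : val_ge n x -> val_ge n y -> val_ge n (x + y).
Proof.
by move=> nx ny; apply: le_trans (dvalD v x y); rewrite le_min; apply/andP.
Qed.

Lemma val_geN n x : val_ge n (- x) = val_ge n x.
Proof. by rewrite /val_ge dvalN. Qed.

Lemma val_geB n x y : val_ge n x -> val_ge n y -> val_ge n (x - y).
Proof. by move=> nx ny; apply: val_geD => //; rewrite val_geN. Qed.

Lemma val_ge_sum (I : Type) (r : seq I) (P : pred I) (f : I -> F) n :
  (forall i, P i -> val_ge n (f i)) -> val_ge n (\sum_(i <- r | P i) f i).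
Proof.
by move=> nf; elim/big_ind: _ => // [|x y]; [exact: val_ge0|exact: val_geD].
Qed.

Lemma val_geM m n x y : val_ge m x -> val_ge n y -> val_ge (m + n) (x * y).
Proof. by move=> mx ny; rewrite /val_ge dvalM EFinD leeD. Qed.

Lemma val_ge1 : val_ge 0 1.
Proof. by rewrite /val_ge dval1. Qed.

Lemma val_ge_nat k : val_ge 0 k%:R.
Proof.
elim: k => [|k IH]; first exact: val_ge0.
by rewrite -addn1 natrD; apply: val_geD => //; exact: val_ge1.
Qed.

Lemma val_geMn n x k : val_ge n x -> val_ge n (x *+ k).
Proof.
by move=> nx; rewrite -mulr_natr -[n]addr0; apply: val_geM => //; exact: val_ge_nat.
Qed.

Lemma dval_ge n x : v x = n%:E -> val_ge n x.
Proof. by rewrite /val_ge => ->. Qed.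

Lemma val_geE m n x : v x = n%:E -> val_ge m x = (m <= n).
Proof. by rewrite /val_ge => ->; rewrite lee_fin. Qed.

Lemma dval_neq0 n x : v x = n%:E -> x != 0.
Proof. by move=> vx; apply/eqP => x0; move: vx; rewrite x0 dval0. Qed.

Lemma dval_eq n x : val_ge n x -> ~~ val_ge (n + 1) x -> v x = n%:E.
Proof.
have [->|/(dval_fin v)[k vx]] := eqVneq x 0; first by rewrite !val_ge0.
rewrite !(val_geE _ vx) vx => nk kn; congr (_%:E); lia.
Qed.

Lemma val_ge_eq0 x : (forall n, val_ge n x) -> x = 0.
Proof.
have [->//|/(dval_fin v)[k vx] /(_ (k + 1))] := eqVneq x 0.
by rewrite (val_geE _ vx); lia.
Qed.

Lemma dvalM_fin m n x y : v x = m%:E -> v y = n%:E -> v (x * y) = (m + n)%:E.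
Proof. by move=> vx vy; rewrite dvalM vx vy. Qed.

Lemma dvalV_fin n x : v x = n%:E -> v x^-1 = (- n)%:E.
Proof. by move=> vx; rewrite dvalV ?vx // (dval_neq0 vx). Qed.

Lemma dvalX_fin n x k : v x = n%:E -> v (x ^+ k) = (k%:Z * n)%:E.
Proof.
move=> vx; elim: k => [|k IH]; first by rewrite expr0 dval1 mul0r.
by rewrite exprS (dvalM_fin vx IH); congr (_%:E); lia.
Qed.

Lemma dvalXz_fin n x (k : int) : v x = n%:E -> v (x ^ k) = (k * n)%:E.
Proof.
move=> vx; case: k => k; first by rewrite -exprnP (dvalX_fin k vx).
by rewrite NegzE -exprnN (dvalV_fin (dvalX_fin _ vx)); congr (_%:E); lia.
Qed.

Lemma dvalD_dom n x y : v x = n%:E -> val_ge (n + 1) y -> v (x + y) = n%:E.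
Proof.
move=> vx ny; apply: dval_eq.
  by apply: val_geD; [exact: dval_ge|apply: val_geW ny; lia].
apply/negP => /val_geB/(_ ny); rewrite addrK (val_geE _ vx); lia.
Qed.

Lemma val_geMl m n x y : v x = m%:E -> val_ge (m + n) (x * y) = val_ge n y.
Proof.
move=> vx; apply/idP/idP => [|ny]; last by apply: val_geM ny; exact: dval_ge.
move=> /(val_geM (dval_ge (dvalV_fin vx))).
by rewrite mulKf ?(dval_neq0 vx) // addKr.
Qed.

(** Nonzero terms with distinct valuations cannot cancel: the term of least valuation dominates, so
    the sum has exactly that valuation. *)
Lemma val_ge_term (I : finType) (f : I -> F) n :
    (forall i j, v (f i) = v (f j) -> f i != 0 -> i = j) ->
  val_ge n (\sum_i f i) -> forall i, val_ge n (f i).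
Proof.
move=> f_inj nf i.
case: (@Order.TotalTheory.arg_minP _ _ I i xpredT (fun j => v (f j)) isT) => k _ minf.
have [fk0|fk0] := eqVneq (f k) 0.
  by apply: le_trans (minf i isT); rewrite fk0 dval0 leey.
have [m vk] := dval_fin v fk0.
have : v (\sum_i f i) = m%:E.
  rewrite (bigD1 k) //=; apply: dvalD_dom => //; apply: val_ge_sum => j kj.
  have [->|/(dval_fin v)[q vj]] := eqVneq (f j) 0; first exact: val_ge0.
  rewrite (val_geE _ vj); have := minf j isT; rewrite vk vj lee_fin.
  have : q != m; last by lia.
  apply: contraNneq kj => qm; apply/eqP/f_inj; first by rewrite vk vj qm.
  by rewrite (dval_neq0 vj).
move=> vs; rewrite (val_geE _ vs) in nf.
by apply: le_trans (minf i isT); rewrite vk lee_fin.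
Qed.

(** A Bezout relation writes 1 as a difference of multiples of [k] and [p], so [k] and [p] cannot
    both have positive valuation. *)
Lemma dval_natr p k :
  prime p -> val_ge 1 p%:R -> ~~ (p %| k)%N -> v k%:R = 0%:E.
Proof.
move=> p_pr vp pk; apply: dval_eq; first exact: val_ge_nat.
have k_gt0 : (0 < k)%N by case: k pk; rewrite ?dvdn0.
have /coprimeP : coprime k p by rewrite coprime_sym prime_coprime.
case=> // -[a b] /= ab; apply/negP => vk; rewrite add0r in vk.
have : val_ge 1 (1 : F).
  rewrite -[1 : F]/(1%:R) -[X in X%:R]ab natrB; last by lia.
  by apply: val_geB; rewrite natrM -[1]add0r; apply: val_geM => //; exact: val_ge_nat.
by rewrite /val_ge dval1 lee_fin.
Qed.

(** The cofactor of [x] in [(1 + x) ^+ k - 1] is a sum of [k] powers of [1 + x], each congruent to 1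
    modulo the maximal ideal. It is congruent to [k], hence a unit. *)
Lemma dval_exp1D p n x k : prime p -> val_ge 1 p%:R -> ~~ (p %| k)%N -> 1 <= n ->
  v x = n%:E -> v ((1 + x) ^+ k - 1) = n%:E.
Proof.
move=> p_pr vp pk n1 vx.
have v1 : val_ge 0 (1 + x).
  by apply: val_geD; [exact: val_ge1|rewrite (val_geE _ vx); lia].
have vX j : val_ge 0 ((1 + x) ^+ j).
  elim: j => [|j IH]; first by rewrite expr0; exact: val_ge1.
  by rewrite exprS -[0]addr0; exact: val_geM.
have vX1 j : val_ge 1 ((1 + x) ^+ j - 1).
  rewrite subrX1 addrAC subrr add0r -[1]addr0; apply: val_geM.
    by rewrite (val_geE _ vx).
  by apply: val_ge_sum => i _; exact: vX.
rewrite subrX1 addrAC subrr add0r -[n in RHS]addr0; apply: dvalM_fin => //.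
have -> : \sum_(i < k) (1 + x) ^+ i = k%:R + \sum_(i < k) ((1 + x) ^+ i - 1).
  by rewrite sumrB sumr_const card_ord [RHS]addrC subrK.
apply: dvalD_dom; first exact: (dval_natr p_pr).
by apply: val_ge_sum.
Qed.

Lemma val_ge_residue_char p : p \in [pchar residue_field v] -> val_ge 1 p%:R.
Proof.
move=> /andP[_ /eqP].
rewrite -(rmorph_nat \pi_({ideal_quot @vmax F v})%qT).
rewrite -(rmorph0 \pi_({ideal_quot @vmax F v})%qT) => /eqP.
rewrite -Quotient.idealrBE subr0 unfold_in /vmax.
have -> : val (p%:R : vring v) = p%:R by exact: (rmorph_nat val).
have [->|/(dval_fin v)[q vq]] := eqVneq (p%:R : F) 0; first by rewrite val_ge0.
by rewrite (val_geE _ vq) vq lte_fin.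
Qed.

End Valuation.

(** * Expansions in powers of a uniformizer *)

Section TotallyRamified.

Variables (p : nat) (K : fieldType) (vK : discrete_valuation K).
Variables (L : splittingFieldType K) (vL : discrete_valuation L).
Hypothesis degreeL : \dim {:L} = p.
Hypothesis ramL : totally_ramified vK vL.
Variable pi : L.
Hypothesis vpi : vL pi = 1%:E.

Lemma dval_alg m (c : K) : vK c = m%:E -> vL c%:A = (p%:Z * m)%:E.
Proof. by move=> vc; case: ramL => _ ->; rewrite vc degreeL. Qed.

Lemma dvalZ m n (c : K) (x : L) :
  vK c = m%:E -> vL x = n%:E -> vL (c *: x) = (p%:Z * m + n)%:E.
Proof. by move=> vc vx; rewrite -mulr_algl; apply: dvalM_fin => //; exact: dval_alg. Qed.

(** Scalars from [K] have valuation divisible by [p] in [L], so the nonzero terms have valuations in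
    distinct classes modulo [p]. The lemma serves both [g i = pi ^+ i] with [k = 0] and
    [g i = s (pi ^+ i) - pi ^+ i] with [k = u]; in the latter family the term [i = 0] vanishes. *)
Lemma val_ge_lincomb (k : int) (g : 'I_p -> L) (c : 'I_p -> K) n :
    (forall i, g i = 0 \/ vL (g i) = (i%:Z + k)%:E) ->
  val_ge vL n (\sum_i c i *: g i) -> forall i, val_ge vL n (c i *: g i).
Proof.
move=> vg; apply: val_ge_term => i j vij; rewrite scaler_eq0 negb_or => /andP[ci0 gi0].
have [a va] := dval_fin vK ci0.
have vgi : vL (g i) = (i%:Z + k)%:E by case: (vg i) => // gi; rewrite gi eqxx in gi0.
rewrite (dvalZ va vgi) in vij; have := dval_neq0 (esym vij).
rewrite scaler_eq0 negb_or => /andP[/(dval_fin vK)[b vb] gj0].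
have vgj : vL (g j) = (j%:Z + k)%:E by case: (vg j) => // gj; rewrite gj eqxx in gj0.
rewrite (dvalZ vb vgj) in vij; case: vij => eq_ij.
apply: val_inj => /=; have := ltn_ord i; have := ltn_ord j => ltj lti.
have [ab|ab|ab] := ltgtP a b; [have : a + 1 <= b by lia|have : b + 1 <= a by lia|].
- by rewrite -(ler_pM2l (_ : 0 < p%:Z)); lia.
- by rewrite -(ler_pM2l (_ : 0 < p%:Z)); lia.
- by rewrite ab in eq_ij; lia.
Qed.

Lemma dval_piX (i : nat) : vL (pi ^+ i) = (i%:Z)%:E.
Proof. by rewrite (dvalX_fin i vpi) mulr1. Qed.

Lemma val_ge_coord (c : 'I_p -> K) n :
  val_ge vL n (\sum_i c i *: pi ^+ i) -> forall i, val_ge vL n (c i *: pi ^+ i).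
Proof. by apply: (@val_ge_lincomb 0) => i; right; rewrite dval_piX addr0. Qed.

(** A vanishing combination has every term of arbitrarily large valuation, so the powers are free;
    there are as many as the dimension. *)
Lemma uniformizer_basis (x : L) : exists c : 'I_p -> K, x = \sum_i c i *: pi ^+ i.
Proof.
pose b := [tuple pi ^+ i | i < p].
have bE (i : 'I_p) : b`_i = pi ^+ i by rewrite -tnth_nth tnth_mktuple.
have b_free : free b.
  apply/freeP => c; under eq_bigr do rewrite bE.
  move=> c0 i; have := @val_ge_coord c; rewrite c0 => /(_ _ (val_ge0 _ _)) vc.
  have /eqP : c i *: pi ^+ i = 0 by apply: (@val_ge_eq0 _ vL) => n; exact: vc.
  by rewrite scaler_eq0 (negPf (dval_neq0 (dval_piX i))) orbF => /eqP.
have b_basis : basis_of {:L} b.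
  by rewrite basisEfree b_free subvf /= size_map size_enum_ord degreeL.
exists (fun i => coord b i x).
by rewrite [LHS](coord_basis b_basis (memvf x)); apply: eq_bigr => i _; rewrite bE.
Qed.

Lemma val_ge_gal_bound (s : gal_of {:L}) :
  exists D : nat, forall n x, val_ge vL n x -> val_ge vL (n - D%:Z) (s x).
Proof.
have spi0 : s pi != 0 by rewrite fmorph_eq0 (dval_neq0 vpi).
have [q vq] := dval_fin vL spi0.
(* On the coordinate [i < p], replacing [pi ^+ i] by its image changes the valuation from [i] to
   [i q], a loss of at most [p + p |q|]. *)
exists (p + p * `|q|)%N => n x; have [c ->] := uniformizer_basis x => /val_ge_coord vc.
rewrite linear_sum; apply: val_ge_sum => i _ /=.
rewrite linearZ rmorphXn /=; have [->|ci0] := eqVneq (c i) 0.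
  by rewrite scale0r val_ge0.
have [a va] := dval_fin vK ci0.
have := vc i; rewrite (val_geE _ (dvalZ va (dval_piX i))) => nle.
rewrite (val_geE _ (dvalZ va (dvalX_fin i vq))).
have := ltn_ord i; move: nle; rewrite !PoszD !PoszM; nia.
Qed.

(* Applied to the powers of x, the bound above loses its constant. *)
Lemma dval_gal (s : gal_of {:L}) x : vL (s x) = vL x.
Proof.
have [D sD] := val_ge_gal_bound s.
have le_gal y m n : vL y = m%:E -> vL (s y) = n%:E -> m <= n.
  move=> vy vsy; have := sD _ _ (dval_ge (dvalX_fin D.+1 vy)).
  rewrite rmorphXn /= (val_geE _ (dvalX_fin D.+1 vsy)); nia.
have [->|x0] := eqVneq x 0; first by rewrite rmorph0.
have [m vx] := dval_fin vL x0.
have [n vsx] : exists n, vL (s x) = n%:E by apply: dval_fin; rewrite fmorph_eq0.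
have := le_gal _ _ _ vx vsx; have := dvalV_fin vsx; rewrite -fmorphV.
move=> /(le_gal _ _ _ (dvalV_fin vx)); rewrite vx vsx => ? ?.
congr (_%:E); lia.
Qed.

Lemma val_ge_gal (s : gal_of {:L}) n x : val_ge vL n (s x) = val_ge vL n x.
Proof. by rewrite /val_ge dval_gal. Qed.

Lemma gal_subE (s : gal_of {:L}) (c : 'I_p -> K) :
  s (\sum_i c i *: pi ^+ i) - \sum_i c i *: pi ^+ i =
  \sum_i c i *: (s (pi ^+ i) - pi ^+ i).
Proof.
rewrite linear_sum -sumrB; apply: eq_bigr => i _.
by rewrite linearZ -scalerBr.
Qed.

Lemma gal_subX (s : gal_of {:L}) k :
  exists2 y, val_ge vL 0 y & s (pi ^+ k) - pi ^+ k = (s pi - pi) * y.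
Proof.
rewrite rmorphXn subrXX; eexists; last by [].
apply: val_ge_sum => i _; rewrite -[0]addr0; apply: val_geM; last first.
  by rewrite (val_geE _ (dval_piX i)).
by rewrite -rmorphXn val_ge_gal (val_geE _ (dval_piX _)).
Qed.

(** This reduces membership in a ramification group to a test on [pi] alone: the coordinates of an
    integral [x] are integral, and [s pi - pi] divides each [s (pi ^+ i) - pi ^+ i]. *)
Lemma val_ge_gal_sub (s : gal_of {:L}) n x :
  val_ge vL n (s pi - pi) -> val_ge vL 0 x -> val_ge vL n (s x - x).
Proof.
move=> ns; have [c ->] := uniformizer_basis x => /val_ge_coord vc.
rewrite gal_subE; apply: val_ge_sum => i _.
have [->|ci0] := eqVneq (c i) 0; first by rewrite scale0r val_ge0.
have [a va] := dval_fin vK ci0.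
have := vc i; rewrite (val_geE _ (dvalZ va (dval_piX i))) => a_ge0.
(* From [p a + i >= 0] and [i < p] it follows that [a > -1]. *)
have {}a_ge0 : 0 <= p%:Z * a
  by rewrite mulr_ge0 // leNgt; apply/negP => a_lt0; have := ltn_ord i; nia.
have [y vy ->] := gal_subX s i.
rewrite -mulr_algl -[n]add0r; apply: val_geM.
  by rewrite (val_geE _ (dval_alg va)).
by rewrite -[n]addr0; apply: val_geM.
Qed.

Lemma gal_in (s : gal_of {:L}) : s \in 'Gal({:L} / 1)%g.
Proof. by rewrite gal_kHom ?sub1v // k1HomE ahomWin. Qed.

Lemma lower_ram_groupE (i : int) (s : gal_of {:L}) :
  (s \in lower_ram_group vL i) = val_ge vL (i + 1) (s pi - pi).
Proof.
rewrite inE gal_in /=; apply/asboolP/idP => [si|si x x0].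
  by apply: si; rewrite vpi lee_fin.
exact: val_ge_gal_sub.
Qed.

End TotallyRamified.

(** * The ramification filtration in degree [p] *)

Section Degree_p.

Variables (p : nat) (K : fieldType) (vK : discrete_valuation K).
Variables (L : splittingFieldType K) (vL : discrete_valuation L).
Hypothesis p_pr : prime p.
Hypothesis galoisL : galois 1 {:L}.
Hypothesis degreeL : \dim {:L} = p.
Hypothesis ramL : totally_ramified vK vL.
Variable pi : L.
Hypothesis vpi : vL pi = 1%:E.

Local Notation G := 'Gal({:L} / 1)%g.

Lemma card_gal : #|G| = p.
Proof. by rewrite -galois_dim // dimv1 divn1. Qed.

Lemma gal_cycle (s : gal_of {:L}) : s != 1%g -> <[s]>%g = G.
Proof.
move=> s1; have sG : <[s]>%g \subset G by rewrite cycle_subG gal_in.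
apply/eqP; rewrite eqEcard sG /= card_gal -orderE dvdn_leq //.
have : (#[s]%g %| p)%N by rewrite -card_gal order_dvdG // gal_in.
move: p_pr => /primeP[_ /[apply]]; rewrite order_eq1 (negPf s1) /=.
by move=> /eqP ->.
Qed.

Lemma lower_ram_group_exp (i : int) (s : gal_of {:L}) k :
  s \in lower_ram_group vL i -> (s ^+ k)%g \in lower_ram_group vL i.
Proof.
rewrite !(lower_ram_groupE degreeL ramL vpi) => si; elim: k => [|k IH].
  by rewrite expg0 gal_id subrr val_ge0.
rewrite expgSr galM ?memvf //.
have -> : s ((s ^+ k)%g pi) - pi = s ((s ^+ k)%g pi - pi) + (s pi - pi).
  by rewrite rmorphB addrA subrK.
by apply: val_geD => //; rewrite (val_ge_gal degreeL ramL vpi).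
Qed.

Section Break.

Variables (s : gal_of {:L}) (u : int).
Hypothesis s_break : vL (s pi - pi) = (u + 1)%:E.

Lemma break_neq1 : s != 1%g.
Proof.
by apply: contraTneq (dval_neq0 s_break) => ->; rewrite gal_id subrr eqxx.
Qed.

(** Every nontrivial element generates the group of prime order, and [G_i] is closed under powers;
    thus [s] alone decides whether [G_i] is everything or trivial. *)
Lemma lower_ram_group_break (i : int) :
  lower_ram_group vL i = if i <= u then G else 1%g.
Proof.
have sE : (s \in lower_ram_group vL i) = (i <= u).
  by rewrite (lower_ram_groupE degreeL ramL vpi) (val_geE _ s_break) lerD2r.
apply/setP => g; case: ifP => iu.
  rewrite gal_in; have := gal_in g; rewrite -(gal_cycle break_neq1).
  by move=> /cycleP[k ->]; rewrite lower_ram_group_exp // sE.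
rewrite [RHS]inE; have [->|g1] := eqVneq g 1%g.
  by rewrite (lower_ram_groupE degreeL ramL vpi) gal_id subrr val_ge0.
apply/negP => gi; move: iu; rewrite -sE.
have := gal_in s; rewrite -(gal_cycle g1) => /cycleP[k ->].
by rewrite lower_ram_group_exp.
Qed.

Lemma lower_ram_numbers_break : lower_ram_numbers vL p [tuple u].
Proof.
split=> // i; rewrite !lower_ram_group_break /= addn0.
have [->|iu] := eqVneq u i.
  rewrite lexx ifF; last by lia.
  by rewrite indexg1 card_gal logn_prime // eqxx.
case: ifP => ui; case: ifP => ui1; rewrite ?indexgg ?logn1 //; lia.
Qed.

Lemma break_ge0 : 0 <= u.
Proof.
have : val_ge vL 1 (s pi - pi).
  by apply: val_geB; rewrite ?(val_ge_gal degreeL ramL vpi) (val_geE _ vpi).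
by rewrite (val_geE _ s_break) lerDr.
Qed.

(** * How [s - 1] moves valuations *)

Section Wild.

Variable e : int.
Hypothesis vp : vK p%:R = e%:E.
Hypothesis e_ge1 : 1 <= e.
Hypothesis u_ge1 : 1 <= u.

Lemma dval_char : vL p%:R = (p%:Z * e)%:E.
Proof. by rewrite -(dval_alg degreeL ramL vp) -scaler_nat. Qed.

Lemma val_ge_char : val_ge vL 1 p%:R.
Proof. by rewrite (val_geE _ dval_char); have := prime_gt1 p_pr; nia. Qed.

Lemma dval_break_exp k : ~~ (p %| k)%N -> vL (s (pi ^+ k) - pi ^+ k) = (k%:Z + u)%:E.
Proof.
(* Here [s pi = pi (1 + x)] with [x] of valuation [u >= 1], so [dval_exp1D] applies. *)
move=> pk; set x := (s pi - pi) / pi.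
have vx : vL x = u%:E.
  by rewrite (dvalM_fin s_break (dvalV_fin vpi)) addrK.
have -> : s (pi ^+ k) - pi ^+ k = pi ^+ k * ((1 + x) ^+ k - 1).
  rewrite mulrBr mulr1 -exprMn rmorphXn mulrDr mulr1 /x.
  by rewrite mulrCA divff ?(dval_neq0 vpi) // mulr1 [pi + _]addrC subrK.
apply: dvalM_fin; first exact: dval_piX.
exact: (dval_exp1D p_pr val_ge_char).
Qed.

Lemma ord_not_dvd (i : 'I_p) : (i : nat) != 0%N -> ~~ (p %| i)%N.
Proof. by move=> i0; rewrite gtnNdvd ?lt0n. Qed.

Lemma val_ge_break_coord (c : K) (i : 'I_p) n : (i : nat) != 0%N ->
  val_ge vL (n + u) (c *: (s (pi ^+ i) - pi ^+ i)) = val_ge vL n (c *: pi ^+ i).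
Proof.
move=> i0; have [->|c0] := eqVneq c 0; first by rewrite !scale0r !val_ge0.
have [a va] := dval_fin vK c0.
rewrite (val_geE _ (dvalZ degreeL ramL va (dval_break_exp (ord_not_dvd i0)))).
rewrite (val_geE _ (dvalZ degreeL ramL va (dval_piX vpi i))); lia.
Qed.

Lemma break_coord0 (c : K) (i : 'I_p) : (i : nat) = 0%N ->
  c *: (s (pi ^+ i) - pi ^+ i) = 0.
Proof. by move=> ->; rewrite expr0 rmorph1 subrr scaler0. Qed.

Lemma val_ge_break n x : val_ge vL n x -> val_ge vL (n + u) (s x - x).
Proof.
have [c ->] := uniformizer_basis degreeL ramL vpi x.
move=> /(val_ge_coord degreeL ramL vpi) vc; rewrite gal_subE.
apply: val_ge_sum => i _; have [i0|i0] := eqVneq (i : nat) 0%N.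
  by rewrite break_coord0 // val_ge0.
by rewrite val_ge_break_coord.
Qed.

(** If the valuation of [s x - x] exceeded [n + u], every coordinate term of [x] with [i != 0] would
    have valuation above [n]. The term [i = 0] has valuation divisible by [p], hence not [n], so [x]
    itself would have valuation above [n]. *)
Lemma dval_break n x :
  vL x = n%:E -> ~~ (p%:Z %| n)%Z -> vL (s x - x) = (n + u)%:E.
Proof.
move=> vx pn; apply: dval_eq; first by apply: val_ge_break; exact: dval_ge.
apply: contraL pn; rewrite negbK addrAC => vsx.
have [c xE] := uniformizer_basis degreeL ramL vpi x.
have vc := val_ge_coord degreeL ramL vpi (_ : val_ge vL n (\sum_i c i *: pi ^+ i)).
rewrite -xE in vc; have {vc}vc := vc (dval_ge vx).
rewrite xE gal_subE in vsx.
have {}vsx := val_ge_lincomb degreeL ramL _ vsx.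
have /vsx {}vsx : forall i : 'I_p, s (pi ^+ i) - pi ^+ i = 0 \/
    vL (s (pi ^+ i) - pi ^+ i) = (i%:Z + u)%:E.
  move=> i; have [i0|i0] := eqVneq (i : nat) 0%N; [left|right].
    by rewrite i0 expr0 rmorph1 subrr.
  by rewrite dval_break_exp // ord_not_dvd.
apply: contraT => pn.
suff : val_ge vL (n + 1) x by rewrite (val_geE _ vx); lia.
rewrite xE; apply: val_ge_sum => i _; have [i0|i0] := eqVneq (i : nat) 0%N; last first.
  by rewrite -val_ge_break_coord.
have := vc i; have [->|c0] := eqVneq (c i) 0; first by rewrite scale0r !val_ge0.
have [a va] := dval_fin vK c0.
rewrite !(val_geE _ (dvalZ degreeL ramL va (dval_piX vpi i))) i0 addr0 => nle.
suff : n != p%:Z * a by lia.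
by apply: contraNneq pn => ->; rewrite dvdz_mulr.
Qed.

(** When [p] divides [n], only the term [i = 0] can attain valuation [n], and [s - 1] kills that
    term. *)
Lemma val_ge_break_dvd n x :
  vL x = n%:E -> (p%:Z %| n)%Z -> val_ge vL (n + u + 1) (s x - x).
Proof.
move=> vx pn; have [c xE] := uniformizer_basis degreeL ramL vpi x.
have vc := val_ge_coord degreeL ramL vpi (_ : val_ge vL n (\sum_i c i *: pi ^+ i)).
rewrite -xE in vc; have {vc}vc := vc (dval_ge vx).
rewrite xE gal_subE; apply: val_ge_sum => i _.
have [i0|i0] := eqVneq (i : nat) 0%N; first by rewrite break_coord0 // val_ge0.
rewrite addrAC val_ge_break_coord //.
have := vc i; have [->|c0] := eqVneq (c i) 0; first by rewrite scale0r !val_ge0.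
have [a va] := dval_fin vK c0.
rewrite !(val_geE _ (dvalZ degreeL ramL va (dval_piX vpi i))) => nle.
suff : n != p%:Z * a + i%:Z by lia.
apply: contraNneq (ord_not_dvd i0) => nE.
by move: pn; rewrite nE rpredDl ?dvdz_mulr.
Qed.

(** * Iterates of [tau] and the relation coming from [s ^ p = 1] *)

Let tau x := s x - x.

(** The binomial expansion of [(1 + tau) ^ j], proved with Pascal's rule. *)
Lemma iter_sub_binom j x :
  (s ^+ j)%g x = \sum_(k < j.+1) iter k tau x *+ 'C(j, k).
Proof.
elim: j => [|j IH]; first by rewrite big_ord1 expg0 gal_id.
rewrite expgSr galM ?memvf // IH raddf_sum /=.
pose f k := iter k tau x.
have sf k : s (f k) = f k.+1 + f k by rewrite /f /= /tau subrK.
rewrite [RHS]big_ord_recl /= bin0.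
under [X in _ = _ + X]eq_bigr do rewrite binS mulrnDr.
rewrite big_split /= addrA.
have -> : x *+ 1 + \sum_(i < j.+1) f i.+1 *+ 'C(j, i.+1) = \sum_(k < j.+1) f k *+ 'C(j, k).
  by rewrite big_ord_recr /= bin_small // mulr0n addr0 [RHS]big_ord_recl bin0.
rewrite -big_split; apply: eq_bigr => k _ /=.
by rewrite raddfMn /= sf mulrnDl addrC.
Qed.

Lemma iter_sub_eq0 x : \sum_(k < p) iter k.+1 tau x *+ 'C(p, k.+1) = 0.
Proof.
have := iter_sub_binom p x; rewrite big_ord_recl /= bin0.
have -> : (s ^+ p)%g = 1%g by apply/eqP; rewrite -card_gal // expg_cardG // gal_in.
rewrite gal_id => /eqP; rewrite -subr_eq0 opprD addrA subrr add0r oppr_eq0.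
by move=> /eqP.
Qed.

Lemma val_ge_bin n y k :
  (0 < k < p)%N -> val_ge vL n y -> val_ge vL (p%:Z * e + n) (y *+ 'C(p, k)).
Proof.
move=> kp ny; have /dvdnP[c ->] := prime_dvd_bin p_pr kp.
rewrite mulnC mulrnA; apply: val_geMn; rewrite -mulr_natl.
by rewrite (val_geMl _ _ dval_char).
Qed.

Hypothesis u_coprime : coprimez u p.

Lemma p_dvd_mulu (n : int) : (p%:Z %| n * u)%Z = (p%:Z %| n)%Z.
Proof. by rewrite Gauss_dvdzl // coprimez_sym. Qed.

(** Before each application of [tau] the valuation is [k u] with [0 < k < p], which is prime to [p],
    so [dval_break] keeps applying until [p u] is reached. *)
Lemma dval_iter x k : vL x = u%:E -> (k < p)%N ->
  vL (iter k tau x) = (k.+1%:Z * u)%:E.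
Proof.
move=> vx; elim: k => [|k IH] kp; first by rewrite mul1r.
rewrite iterS /tau (dval_break (IH (ltnW kp))); first by congr (_%:E); lia.
by rewrite p_dvd_mulu dvdzE /= gtnNdvd.
Qed.

(* For v x = u, the iterates x, tau x, ..., tau^(p-1) x have valuations
   u, 2u, ..., pu. In tau^p x + ... + p tau x = 0 the term p tau x
   must be matched by tau^p x, whose valuation exceeds (p + 1)u since p
   divides v (tau^(p-1) x). *)
Lemma tolerance_ge1 : 1 <= p%:Z * e - (p%:Z - 1) * u.
Proof.
have [x vx] := dval_surj vL u; rewrite leNgt; apply/negP => T_le0.
have := iter_sub_eq0 x; rewrite -(prednK (prime_gt0 p_pr)) big_ord_recl /= => tS0.
have p_gt1 := prime_gt1 p_pr.
have vf1 : vL (tau x *+ 'C(p.-1.+1, 1)) = (p%:Z * e + 2 * u)%:E.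
  rewrite prednK ?prime_gt0 // bin1 -[_ *+ p]mulr_natl.
  exact: (dvalM_fin dval_char (dval_iter vx p_gt1)).
suff : vL 0 = (p%:Z * e + 2 * u)%:E by rewrite dval0.
rewrite -[X in vL X]tS0; apply: dvalD_dom => //; apply: val_ge_sum => k _.
rewrite prednK ?prime_gt0 //; rewrite /bump leq0n add1n add0n.
move: (nat_of_ord k) (ltn_ord k) => {}k ltk.
have [kp|kp] := eqVneq (k.+2) p.
  rewrite kp binn mulr1n -[tau (iter k tau x)]iterS.
  apply: val_geW (val_ge_break_dvd (dval_iter vx _) _).
  - by nia.
  - by lia.
  - by rewrite p_dvd_mulu -kp.
rewrite -addrA; apply: val_ge_bin; first by lia.
have kp' : (k.+2 < p)%N by lia.
by apply: val_geW (dval_ge (dval_iter vx kp')); nia.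
Qed.

(** Dividing the iterates by a [tau]-constant [S] makes [tau] lower the index exactly. Only [mu 0]
    is altered, from [tau^(p-1) x / S] to 1, so the sole error sits in the relation from index 1 to
    index 0. *)
Lemma scaffold_basis : exists mu : nat -> L,
  [/\ mu 0%N = 1, forall a, (a < p)%N -> vL (mu a) = (- (a%:Z * u))%:E,
      val_ge vL (p%:Z * e - (p%:Z - 1) * u) (s (mu 1%N) - mu 1%N - 1) &
      forall a, (0 < a)%N -> (a.+1 < p)%N -> s (mu a.+1) - mu a.+1 = mu a].
Proof.
have T_ge1 := tolerance_ge1; have p_gt1 := prime_gt1 p_pr.
have [x vx] := dval_surj vL u; pose f k := iter k tau x.
(* [r] gathers the terms whose binomial coefficient is divisible by [p]; [tau S] is the sum that
   vanishes in [iter_sub_eq0]. *)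
pose r := \sum_(k < p.-1) f k *+ 'C(p, k.+1); pose S := r + f p.-1.
have SE : S = \sum_(k < p) f k *+ 'C(p, k.+1).
  rewrite -[in RHS](@prednK p) ?prime_gt0 // big_ord_recr /= prednK ?prime_gt0 //.
  by rewrite binn mulr1n.
have sS : s S = S.
  apply/eqP; rewrite -subr_eq0 SE raddf_sum -sumrB -[X in _ == X](iter_sub_eq0 x).
  by apply/eqP/eq_bigr => k _; rewrite raddfMn -mulrnBl.
have vr : val_ge vL (p%:Z * e + u) r.
  apply: val_ge_sum => k _; apply: val_ge_bin; first by have := ltn_ord k; lia.
  have kp : (k < p)%N by have := ltn_ord k; lia.
  by apply: val_geW (dval_ge (dval_iter vx kp)); nia.
have vfp : vL (f p.-1) = (p%:Z * u)%:E.
  by rewrite (dval_iter vx) ?prednK ?prime_gt0.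
(* The bound on [r] is [p e + u = p u + T], strictly above [p u] because [T >= 1]. *)
have vS : vL S = (p%:Z * u)%:E.
  by rewrite /S addrC; apply: dvalD_dom => //; apply: val_geW vr; nia.
have S0 := dval_neq0 vS.
have stau a : (0 < a < p)%N ->
    s (f (p.-1 - a)%N / S) - f (p.-1 - a)%N / S = f (p.-1 - a).+1 / S.
  by move=> ap; rewrite rmorphM fmorphV /= sS -mulrBl.
exists (fun a => if a == 0%N then 1 else f (p.-1 - a)%N / S); split=> //.
- case=> [|a] ap /=; first by rewrite dval1 mul0r.
  rewrite (dvalM_fin (dval_iter vx _) (dvalV_fin vS)); last by lia.
  have -> : (p.-1 - a.+1).+1%:Z = p%:Z - a.+1%:Z by lia.
  by congr (_%:E); ring.
- rewrite /= stau ?p_gt1 // (_ : (p.-1 - 1).+1 = p.-1); last by lia.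
  (* The error [r / S] has valuation at least [(p e + u) - p u], which is [T]. *)
  have -> : f p.-1 / S - 1 = - (r / S).
    by rewrite -[X in _ - X](divff S0) -mulrBl /S opprD addrCA subrr addr0 mulNr.
  rewrite val_geN; apply: val_geW (val_geM vr (dval_ge (dvalV_fin vS))); lia.
- move=> a a0 ap /=; rewrite stau ?ap // ifF; last by lia.
  by congr (f _ / S); lia.
Qed.

End Wild.
End Break.
End Degree_p.

(** * The residue function [shift_a] for [n = 1] *)

Section ShiftDegree_p.

Variables (p : nat) (u : int).
Hypothesis p_gt0 : (0 < p)%N.
Hypothesis u_coprime : coprimez u p.

Local Notation shift := (shift_a p [tuple u]).

Lemma shift_b1 a : (a < p)%N -> shift_b p [tuple u] a = a%:Z * u.
Proof.
by move=> ap; rewrite /shift_b big_ord1 /digit subnn expn0 divn1 modn_small // muln1.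
Qed.

Lemma shift_a_congr j a : (a < p)%N ->
  (j == - shift_b p [tuple u] a %[mod (p ^ 1)%N%:Z])%Z = (p%:Z %| j + a%:Z * u)%Z.
Proof. by move=> ap; rewrite expn1 shift_b1 // eqz_mod_dvd opprK. Qed.

(** The filtered list must be shown nonempty, since otherwise [head] would return its default 0.
    With [w u + z p = 1], the residue of [- j w] modulo [p] is a member. *)
Lemma shift_a1P j : (shift j < p)%N /\ (p%:Z %| j + (shift j)%:Z * u)%Z.
Proof.
pose r := [seq a <- iota 0 (p ^ 1) |
            (j == - shift_b p [tuple u] a %[mod (p ^ 1)%N%:Z])%Z].
have rE a : a \in r = (a < p)%N && (p%:Z %| j + a%:Z * u)%Z.
  rewrite mem_filter mem_iota /= add0n {2}expn1 andbC.
  by case: ltnP => // ap; rewrite /= shift_a_congr.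
suff : shift j \in r by rewrite rE => /andP.
suff : r != [::] by rewrite /shift_a -/r; case: (r) => //= a ? _; rewrite mem_head.
have /coprimezP[[w z] /= wz] := u_coprime.
pose a := (- (j * w) %% p%:Z)%Z.
have a_ge0 : 0 <= a by apply: modz_ge0; lia.
have a_lt : a < p%:Z by apply: ltz_pmod; lia.
suff : `|a|%N \in r by case: (r).
rewrite rE gez0_abs // (_ : (`|a| < p)%N) /=; last by lia.
have aE : a = - (j * w) - (- (j * w) %/ p%:Z)%Z * p%:Z.
  by rewrite {1}(divz_eq (- (j * w)) p%:Z) addrAC subrr add0r.
apply/dvdzP; exists (j * z - (- (j * w) %/ p%:Z)%Z * u).
rewrite aE; set q := (_ %/ _)%Z; rewrite -{1}[j]mulr1 -wz; ring.
Qed.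

Lemma shift_a1_uniq j a :
  (a < p)%N -> (p%:Z %| j + a%:Z * u)%Z -> shift j = a.
Proof.
have [bp pb] := shift_a1P j; set b := shift j in bp pb *.
move=> ap pa; have := rpredB pb pa; rewrite opprD addrACA subrr add0r -mulrBl.
rewrite Gauss_dvdzl 1?coprimez_sym // -eqz_mod_dvd => /eqP.
have mod_small c : (c < p)%N -> (c%:Z %% p%:Z)%Z = c by move=> ?; apply: modz_small; lia.
by rewrite !mod_small // => -[].
Qed.

Lemma shift_a1_add j (k : int) : shift (j + k * p%:Z) = shift j.
Proof.
have [bp pb] := shift_a1P j; apply: shift_a1_uniq => //.
by rewrite addrAC rpredD // dvdz_mull.
Qed.

(** The identity [j + a u = (j + u) + (a - 1) u] and uniqueness: moving by [u] along the scaffold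
    lowers the digit by one. *)
Lemma shift_a1_pred j : (0 < shift j)%N -> shift (j + u) = (shift j).-1.
Proof.
have [bp pb] := shift_a1P j => b0; apply: shift_a1_uniq; first by lia.
have bE : (shift j)%:Z = 1 + (shift j).-1%:Z by lia.
by move: pb; rewrite {1}bE mulrDl mul1r addrA.
Qed.

End ShiftDegree_p.

(** * The element [s - 1] of the group algebra and the assembly of the scaffold *)

Lemma group_alg_act_sub (K : fieldType) (L : splittingFieldType K)
    (s : gal_of {:L}) (x : L) :
  group_alg_act [ffun g => (g == s)%:R - (g == 1%g)%:R] x = s x - x.
Proof.
have sum1 (t : gal_of {:L}) : \sum_(g in 'Gal({:L} / 1)%g) (g == t)%:R *: g x = t x.
  rewrite (bigD1 t) ?gal_in //= eqxx scale1r big1 ?addr0 // => g /andP[_ /negPf ->].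
  by rewrite scale0r.
rewrite /group_alg_act; under eq_bigr do rewrite ffunE scalerBl.
by rewrite sumrB !sum1 gal_id.
Qed.

Theorem theorem3p1 (p : nat) (K : fieldType) (vK : discrete_valuation K)
    (L : splittingFieldType K) (vL : discrete_valuation L) (u : int)
    (charK : [pchar K] =i pred0)
    (completeK : complete_valuation vK)
    (char_residue : p \in [pchar residue_field vK])
    (perfect_residue : perfect_field (residue_field vK))
    (galoisL : galois 1 {:L})
    (cyclicL : cyclic 'Gal({:L} / 1)%g)
    (degreeL : \dim {:L} = p)
    (ramL : totally_ramified vK vL)
    (ram_u : lower_ram_number vL u)
    (coprime_u : coprimez u p) :
  let T : int := p%:Z * fine (vK p%:R) - (p%:Z - 1) * u in
  [/\ 1 <= T,
      exists (sigma : gal_of {:L}) (X : L),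
        [/\ generator 'Gal({:L} / 1)%g sigma,
            vL X = (- u)%:E &
            (T%:E <= vL (sigma X - X - 1)%R)%E] &
      forall piK : K, vK piK = 1%:E ->
        has_galois_scaffold p 1 vK vL piK T].
Proof.
have p_pr : prime p by case/andP: char_residue.
have p_gt0 := prime_gt0 p_pr; have p_gt1 := prime_gt1 p_pr.
have pK0 : p%:R != 0 :> K by have := charK p; rewrite !inE p_pr => /negbT.
have [e vp] := dval_fin vK pK0; rewrite vp /=.
have e_ge1 : 1 <= e by have := val_ge_residue_char char_residue; rewrite (val_geE _ vp).
have [pi vpi] := dval_surj vL 1.
(* [G_(u+1)] lies in [G_u] and differs from it, so some [s] belongs to [G_u] only. *)
have [s s_break] : exists s : gal_of {:L}, vL (s pi - pi) = (u + 1)%:E.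
  have [/existsP[s /andP[]]|/existsPn su] :=
      boolP [exists s, (s \in lower_ram_group vL u)
                     && (s \notin lower_ram_group vL (u + 1))].
    by rewrite !(lower_ram_groupE degreeL ramL vpi) => su su1; exists s; exact: dval_eq.
  case/negP: ram_u; apply/eqP/setP => s; apply/idP/idP.
    by move=> si; have := su s; rewrite si negbK.
  by rewrite !(lower_ram_groupE degreeL ramL vpi); apply: val_geW; lia.
(* The value [u = 0] is excluded because [gcd(0, p) = p]. *)
have u_ge1 : 1 <= u.
  have := break_ge0 degreeL ramL vpi s_break; rewrite le_eqVlt => /orP[/eqP u0|]; last by lia.
  by move: coprime_u; rewrite -u0 /coprimez gcd0z; lia.
have T_ge1 := tolerance_ge1 p_pr galoisL degreeL ramL vpi s_break vp e_ge1 u_ge1 coprime_u.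
have [mu [mu0 vmu smu1 smu]] :=
  scaffold_basis p_pr galoisL degreeL ramL vpi s_break vp e_ge1 u_ge1 coprime_u.
split=> //.
  exists s, (mu 1%N); split; last exact: smu1.
    by rewrite /generator (gal_cycle p_pr galoisL degreeL (break_neq1 s_break)).
  by rewrite vmu // mul1r.
move=> piK vpiK; split; first by rewrite expn1.
exists [tuple u]; split.
- exact: (lower_ram_numbers_break p_pr galoisL degreeL ramL vpi s_break).
- by move=> i; rewrite ord1.
have shiftP := shift_a1P p_gt0 coprime_u.
(* Since [mu a] has valuation [- a u] and [piK] has valuation [p] in [L], this power of [piK] brings
   the valuation to exactly [j]. *)
pose lambda j : L := let a := shift_a p [tuple u] j in
  piK ^ ((j + a%:Z * u) %/ p%:Z)%Z *: mu a.
exists lambda, (fun _ => [ffun g => (g == s)%:R - (g == 1%g)%:R]); split.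
- move=> t; have [ap pa] := shiftP t.
  rewrite (dvalZ degreeL ramL (dvalXz_fin _ vpiK) (vmu _ ap)) mulr1 mulrC divzK //.
  by rewrite addrK.
- move=> t; rewrite /lambda expn1.
  have -> : shift_a p [tuple u] (t + p%:Z) = shift_a p [tuple u] t.
    by rewrite -[p%:Z]mul1r shift_a1_add.
  have p_neq0 : p%:Z != 0 by lia.
  rewrite addrAC (addrC _ p%:Z) -{1}[p%:Z]mul1r divzMDl //.
  by rewrite expfzDr ?(dval_neq0 vpiK) // expr1z scalerA.
- by move=> i; rewrite group_alg_act_sub rmorph1 subrr.
move=> i j; rewrite ord1 /= group_alg_act_sub subnn expn0 mul1r.
have [ap pa] := shiftP j.
rewrite /digit expn0 divn1 modn_small // tnth0.
(* For digit 0, [lambda j] is a scalar from [K], so [s - 1] kills it. *)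
case: posnP => [a0|a_gt0].
  exists 0; first by rewrite dval0 leey.
  by rewrite /lambda a0 mu0 linearZ rmorph1 subrr mul0r mulr0 subr0.
have aE : shift_a p [tuple u] j = (shift_a p [tuple u] j).-1.+1 by rewrite prednK.
rewrite mul1r /lambda (shift_a1_pred p_gt0 coprime_u a_gt0).
have -> : j + u + (shift_a p [tuple u] j).-1%:Z * u = j + (shift_a p [tuple u] j)%:Z * u.
  by rewrite [in RHS]aE; lia.
(* Both sides now carry the same power of [piK], so only the relations between the [mu a] remain. *)
move: (piK ^ _) => c; move: aE ap a_gt0 => {}aE; rewrite {}aE /=.
move: (_.-1) => {j pa} a ap _; rewrite linearZ -scalerBr -scalerBr.
(* Digit 1 is the one inexact case, with relative error [tau (mu 1) - 1]; larger digits give error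
   0. *)
case: a ap => [|a] ap.
  by exists (s (mu 1%N) - mu 1%N - 1); rewrite // mu0 -scalerAl mul1r.
exists 0; first by rewrite dval0 leey.
by rewrite smu // subrr scaler0 mulr0.
Qed.
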